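(* For every integer $n\ge 3$, $\mu_{\rm t}(L(K_n))={\rm ex}(n;C_4)$.
   Context: $L(K_n)$ is the line graph of the complete graph $K_n$. For a connected graph $H$ and $X\subseteq V(H)$, two vertices are $X$-visible if there is a shortest path between them whose internal vertices are not in $X$; $X$ is a total mutual-visibility set if every two vertices of $H$ are $X$-visible, and $\mu_{\rm t}(H)$ is the maximum cardinality of such a set. The Turán number ${\rm ex}(n;H')$ is the maximum number of edges of an $n$-vertex graph not containing $H'$ as a subgraph; $C_4$ is the $4$-cycle. *)

(* Defs.v *)
From mathcomp Require Import all_boot.
From mathcomp Require Import boolp.

Set Implicit Arguments.
Unset Strict Implicit.
Unset Printing Implicit Defensive.

Record sgraph := SGraph {
  vertex :> finType;
  adj : rel vertex;
  adj_sym : symmetric adj;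
  adj_irrefl : irreflexive adj }.

Definition edges (G : sgraph) : {set {set G}} :=
  [set [set p.1; p.2] | p : G * G & adj p.1 p.2].

(* A path from [x] to [y] is given by the sequence [p] of the vertices that
   follow [x]; its length is [size p]. *)
Definition is_path (G : sgraph) (x y : G) (p : seq G) : Prop :=
  [/\ path (@adj G) x p, uniq (x :: p) & last x p = y].

Definition shortest_path (G : sgraph) (x y : G) (p : seq G) : Prop :=
  is_path x y p /\ forall q : seq G, is_path x y q -> size p <= size q.

(* [x :: p] without its first and last elements. *)
Definition internal_vertices (G : sgraph) (x : G) (p : seq G) : seq G :=
  behead (belast x p).

Definition visible (G : sgraph) (X : {set G}) (x y : G) : Prop :=
  exists2 p : seq G, shortest_path x y p &
    forall z : G, z \in internal_vertices x p -> z \notin X.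

Definition total_mutual_visibility (G : sgraph) (X : {set G}) : Prop :=
  forall x y : G, visible X x y.

(* Meaningful for connected [G], where [set0] satisfies the condition; for a
   disconnected [G] no set does and the value is 0. *)
Definition mu_t (G : sgraph) : nat :=
  \max_(X : {set G} | `[< total_mutual_visibility X >]) #|X|.

Definition contains (G H : sgraph) : Prop :=
  exists f : H -> G,
    injective f /\ forall x y : H, adj x y -> adj (f x) (f y).

Lemma neq_sym (T : eqType) : symmetric (fun x y : T => x != y).
Proof. by move=> x y; rewrite eq_sym. Qed.

Lemma neq_irrefl (T : eqType) : irreflexive (fun x y : T => x != y).
Proof. by move=> x; rewrite eqxx. Qed.

Definition complete_graph (n : nat) : sgraph :=
  SGraph (@neq_sym 'I_n) (@neq_irrefl 'I_n).

Definition line_adj (G : sgraph) : rel {e : {set G} | e \in edges G} :=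
  fun e f => (e != f) && (val e :&: val f != set0).

Lemma line_adj_sym (G : sgraph) : symmetric (@line_adj G).
Proof. by move=> e f; rewrite /line_adj eq_sym setIC. Qed.

Lemma line_adj_irrefl (G : sgraph) : irreflexive (@line_adj G).
Proof. by move=> e; rewrite /line_adj eqxx. Qed.

Definition line_graph (G : sgraph) : sgraph :=
  SGraph (@line_adj_sym G) (@line_adj_irrefl G).

Definition cycle4_adj : rel 'I_4 :=
  fun i j => (j == ordS i) || (i == ordS j).

Lemma cycle4_adj_sym : symmetric cycle4_adj.
Proof. by move=> i j; rewrite /cycle4_adj orbC. Qed.

Lemma cycle4_adj_irrefl : irreflexive cycle4_adj.
Proof. by case=> [[|[|[|[|]]]]]. Qed.

Definition C4 : sgraph := SGraph cycle4_adj_sym cycle4_adj_irrefl.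

Definition edge_set_adj (n : nat) (E : {set {set 'I_n}}) : rel 'I_n :=
  fun x y => (x != y) && ([set x; y] \in E).

Lemma edge_set_adj_sym (n : nat) (E : {set {set 'I_n}}) :
  symmetric (edge_set_adj E).
Proof. by move=> x y; rewrite /edge_set_adj eq_sym setUC. Qed.

Lemma edge_set_adj_irrefl (n : nat) (E : {set {set 'I_n}}) :
  irreflexive (edge_set_adj E).
Proof. by move=> x; rewrite /edge_set_adj eqxx. Qed.

Definition edge_set_graph (n : nat) (E : {set {set 'I_n}}) : sgraph :=
  SGraph (edge_set_adj_sym E) (edge_set_adj_irrefl E).

Lemma edges_edge_set_graph (n : nat) (E : {set {set 'I_n}}) :
  E \subset edges (complete_graph n) -> edges (edge_set_graph E) = E.
Proof.
move=> /subsetP sE; apply/setP => e; apply/imsetP/idP.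
  by case=> -[x y]; rewrite inE /= => /andP[_ xyE] ->.
move=> eE; have /imsetP[[x y]] := sE e eE; rewrite inE /= => xy exy.
by exists (x, y) => //; rewrite inE /= /edge_set_adj -exy xy.
Qed.

(* The graphs on the vertex set ['I_n] represent all n-vertex graphs up to
   isomorphism; each is given by its edge set, see [edges_edge_set_graph]. *)
Definition turan_number (n : nat) (H : sgraph) : nat :=
  \max_(E : {set {set 'I_n}} | (E \subset edges (complete_graph n)) &&
                               `[< ~ contains (edge_set_graph E) H >]) #|E|.

(* Main.v *)
Require Import Defs.
From mathcomp Require Import all_boot.
From mathcomp Require Import boolp.

Set Implicit Arguments.
Unset Strict Implicit.
Unset Printing Implicit Defensive.

(** In [L(K_n)] two vertices that are neither equal nor adjacent are disjoint
    edges [ac] and [bd] of [K_n]; they are at distance 2 and their common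
    neighbours are the four edges [ab], [bc], [cd], [da] of a 4-cycle. Hence
    they fail to be [X]-visible exactly when this 4-cycle lies in [X], and so
    the total mutual-visibility sets are the edge sets of the [C_4]-free
    graphs. *)

Lemma adj_neq (G : sgraph) (x y : G) : adj x y -> x != y.
Proof. by apply: contraTneq => ->; rewrite adj_irrefl. Qed.

Lemma visible_refl (G : sgraph) (X : {set G}) (x : G) : visible X x x.
Proof. by exists [::] => //; split. Qed.

Lemma visible_adj (G : sgraph) (X : {set G}) (x y : G) :
  adj x y -> visible X x y.
Proof.
move=> xy; have nxy := adj_neq xy.
exists [:: y] => //; split; first by split; rewrite //= ?xy // inE nxy.
by case=> [|//] [_ _ /= exy]; rewrite exy eqxx in nxy.
Qed.

(** The common neighbour [w] makes the distance exactly 2, so the shortest paths are precisely the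
    sequences [[:: z; y]] with [z] a common neighbour, and [z] is their only internal vertex. *)
Lemma visible_dist2 (G : sgraph) (X : {set G}) (x y w : G) :
  x != y -> ~~ adj x y -> adj x w -> adj w y ->
  visible X x y <-> exists z, [/\ adj x z, adj z y & z \notin X].
Proof.
move=> nxy naxy.
have path2 z : adj x z -> adj z y -> is_path x y [:: z; y].
  move=> xz zy; split; rewrite //= ?xz ?zy // !inE negb_or nxy.
  by rewrite (adj_neq xz) (adj_neq zy).
have dist2 q : is_path x y q -> 2 <= size q.
  case: q => [|u [|//]] [/= pq _ exy]; first by rewrite exy eqxx in nxy.
  by rewrite -exy -(andbT (adj x u)) pq in naxy.
move=> xw wy; split=> [[p [pp minp] pX] | [z [xz zy zX]]].
  have := minp _ (path2 _ xw wy); have := dist2 _ pp.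
  case: p pp {minp} pX => [|z [|u [|//]]] // [/= /and3P[xz zu _] _ <-] pX _ _.
  by exists z; split; rewrite // pX // inE.
exists [:: z; y]; first by split; [exact: path2 | exact: dist2].
by move=> u; rewrite inE => /eqP->.
Qed.

(** Adjacent vertices are distinct, so beyond the four sides, injectivity of the embedding only
    requires opposite corners to differ. *)
Lemma contains_C4 (G : sgraph) :
  contains G C4 <->
  exists a b c d : G, [/\ a != c, b != d & [/\ adj a b, adj b c, adj c d & adj d a]].
Proof.
split=> [[f [f_inj fadj]] | [a [b [c [d [ac bd [ab bc cd da]]]]]]].
  have f_neq (i j : 'I_4) : i != j -> f i != f j by apply: contra_neq => /f_inj.
  exists (f (@Ordinal 4 0 isT)), (f (@Ordinal 4 1 isT)),
    (f (@Ordinal 4 2 isT)), (f (@Ordinal 4 3 isT)).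
  by split; [exact: f_neq | exact: f_neq | split; exact: fadj].
have s_uniq : uniq [:: a; b; c; d].
  rewrite /= !inE !negb_or ac bd (adj_neq ab) (adj_neq bc).
  by rewrite (adj_neq cd) eq_sym (adj_neq da).
(* The default [a] is never returned, as every index is below 4; [s_uniq] then gives injectivity. *)
exists (fun i : 'I_4 => nth a [:: a; b; c; d] i); split=> [i j eij | i j].
  by apply/val_inj/eqP; rewrite -(nth_uniq a _ _ s_uniq) ?ltn_ord // eij.
by case: i => -[|[|[|[|//]]]] ?; case: j => -[|[|[|[|//]]]] ? //= _;
  rewrite // adj_sym.
Qed.

Lemma edges_complete (n : nat) (a b : 'I_n) :
  ([set a; b] \in edges (complete_graph n)) = (a != b).
Proof.
apply/imsetP/idP => [[[x y]] | ab]; last by exists (a, b); rewrite // inE.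
rewrite inE /= => xy eab; apply: contraNneq xy => ab.
have : x \in [set a; b] by rewrite eab set21.
have : y \in [set a; b] by rewrite eab set22.
by rewrite ab !inE !orbb => /eqP-> /eqP->.
Qed.

Lemma complete_edgeP (n : nat) (e : line_graph (complete_graph n)) :
  exists a b : 'I_n, a != b /\ val e = [set a; b].
Proof.
by case: e => e /= /imsetP[[a b]]; rewrite inE /= => ab ->; exists a, b.
Qed.

Lemma tmv_line_complete (n : nat) (X : {set line_graph (complete_graph n)}) :
  total_mutual_visibility X <->
  ~ contains (edge_set_graph (val @: X : {set {set 'I_n}})) C4.
Proof.
set L := line_graph _ in X *.
have mem_val (e : L) : (val e \in val @: X) = (e \in X).
  by rewrite mem_imset //; exact: val_inj.
pose E (a b : 'I_n) (ab : a != b) : L :=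
  Sub [set a; b] (etrans (edges_complete a b) ab).
have adj_val (e f : L) (a : 'I_n) :
    val e != val f -> a \in val e -> a \in val f -> adj e f.
  move=> nef ae af; rewrite /= /line_adj -val_eqE nef /=.
  by apply/set0Pn; exists a; rewrite inE ae.
have neq_mem (a : 'I_n) (A B : {set 'I_n}) :
  a \in A -> a \notin B -> A != B by move=> aA; apply: contraNneq => <-.
split=> [tmv | noC4 x y].
  case/contains_C4=> a [b [c [d [ac bd [/= ab bc cd da]]]]].
  move: ab bc cd da => /andP[ab abX] /andP[bc bcX] /andP[cd cdX] /andP[da daX].
  (* The diagonals [ac] and [bd] of the 4-cycle will be the pair that is not visible; the side [ab]
     serves only to show that their distance is 2. *)
  have xw : adj (E _ _ ac) (E _ _ ab).
    apply: (adj_val _ _ a); rewrite /= ?inE ?eqxx //.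
    by apply: (neq_mem c); rewrite !inE ?eqxx ?orbT // negb_or ![c == _]eq_sym ac.
  have wy : adj (E _ _ ab) (E _ _ bd).
    apply: (adj_val _ _ b); rewrite /= ?inE ?eqxx ?orbT //.
    by apply: (neq_mem a); rewrite !inE ?eqxx ?orbT // negb_or ab eq_sym.
  have xy0 : [set a; c] :&: [set b; d] = set0.
    apply/setP=> u; rewrite !inE; apply/negP => /andP[].
    by case/orP=> /eqP->; rewrite ?(negbTE ab) ?(negbTE cd) ?[_ == b]eq_sym
      ?(negbTE bc) ?[a == d]eq_sym ?(negbTE da).
  have nxy : E _ _ ac != E _ _ bd.
    rewrite -val_eqE /=; apply: contra_eq_neq xy0 => <-; rewrite setIid.
    by apply/set0Pn; exists a; rewrite set21.
  have naxy : ~~ adj (E _ _ ac) (E _ _ bd) by rewrite /= /line_adj /= xy0 eqxx andbF.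
  have [z [xz zy /negP[]]] := (visible_dist2 X nxy naxy xw wy).1 (tmv _ _).
  rewrite -mem_val.
  have [p [q [pq ez]]] := complete_edgeP z.
  (* A common neighbour [z] of the diagonals has an end [u] in [ac] and an end [v] in [bd]. Having
     two elements, it equals [[set u; v]], one of the four sides, all of which lie in [X]. *)
  have mem2 (u v : 'I_n) : u \in val z -> v \in val z -> u != v -> val z = [set u; v].
    rewrite ez !inE => /orP[]/eqP-> /orP[]/eqP->; rewrite ?eqxx // => _.
    exact: setUC.
  move: xz zy => /= /andP[_ /set0Pn[u]] + /andP[_ /set0Pn[v]].
  rewrite !inE /= => /andP[ux uz] /andP[vz vy].
  case/orP: ux uz => /eqP-> uz; case/orP: vy vz => /eqP-> vz.
  - by rewrite (mem2 _ _ uz vz ab).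
  - by rewrite (mem2 _ _ vz uz da).
  - by rewrite (mem2 _ _ vz uz bc).
  - by rewrite (mem2 _ _ uz vz cd).
have [->|nxy] := eqVneq x y; first exact: visible_refl.
have [/visible_adj//|naxy] := boolP (adj x y).
have [a [c [ac ex]]] := complete_edgeP x.
have [b [d [bd ey]]] := complete_edgeP y.
(* A shared endpoint would make the distinct edges [x] and [y] adjacent. *)
have dxy (u v : 'I_n) : u \in val x -> v \in val y -> u != v.
  move=> ux vy; apply: contraNneq naxy => uv.
  by apply: (adj_val _ _ u); rewrite ?val_eqE // uv.
have [ax cx] : a \in val x /\ c \in val x by rewrite ex !inE !eqxx orbT.
have [By dy] : b \in val y /\ d \in val y by rewrite ey !inE !eqxx orbT.
(* The edge [uv] meets both [x] and [y], and it differs from each of them because [v] is outside [x]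
   and [u] is outside [y]. *)
have adjE (u v : 'I_n) (uv : u != v) : u \in val x -> v \in val y ->
    adj x (E _ _ uv) /\ adj (E _ _ uv) y.
  move=> ux vy; split.
    apply: (adj_val _ _ u); rewrite //= ?set21 // eq_sym.
    apply: (neq_mem v); rewrite ?set22 //.
    by apply/negP => vx; have := dxy _ _ vx vy; rewrite eqxx.
  apply: (adj_val _ _ v); rewrite //= ?set22 //.
  apply: (neq_mem u); rewrite ?set21 //.
  by apply/negP => uy; have := dxy _ _ ux uy; rewrite eqxx.
have [xw wy] := adjE _ _ (dxy _ _ ax By) ax By.
(* If every common neighbour lies in [X], so do all edges between an end of [x] and an end of [y].
   The cycle [a b c d] alternates between these ends, hence all its sides are in [X]. *)
apply: (visible_dist2 X nxy naxy xw wy).2; apply: contrapT => noz; apply: noC4.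
have inX (u v : 'I_n) : u \in val x -> v \in val y ->
    adj (u : edge_set_graph (val @: X)) v.
  move=> ux vy; have uv := dxy _ _ ux vy; rewrite /= /edge_set_adj uv /=.
  have [xz zy] := adjE _ _ uv ux vy.
  rewrite (_ : [set u; v] = val (E _ _ uv)) // mem_val.
  by apply/negPn/negP => zX; apply: noz; exists (E _ _ uv).
apply/contains_C4; exists a, b, c, d.
by split=> //; split; do ?[exact: inX | rewrite adj_sym; exact: inX].
Qed.

Theorem theorem3p7 (n : nat) (hn : 3 <= n) :
  mu_t (line_graph (complete_graph n)) = turan_number n C4.
Proof.
set L := line_graph (complete_graph n).
have card_val (X : {set L}) : #|(val @: X : {set {set 'I_n}})| = #|X|.
  by rewrite card_imset //; exact: val_inj.
(* Since [val] is injective, passing between sets of vertices of [L] and edge sets of the complete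
   graph preserves cardinality, so each maximum bounds the other. *)
apply/eqP; rewrite eqn_leq; apply/andP; split.
  apply/bigmax_leqP => X /asboolP/tmv_line_complete noC4; rewrite -card_val.
  apply: leq_bigmax_cond; apply/andP; split; last exact/asboolP.
  by apply/subsetP => _ /imsetP[e _ ->]; exact: valP.
apply/bigmax_leqP => F /andP[/subsetP sF /asboolP noC4].
(* Pulling [F] back along [val] loses nothing, because every member of [F] is an edge of the
   complete graph. *)
pose X : {set L} := [set e | val e \in F].
have FX : F = val @: X.
  apply/setP => e; apply/idP/imsetP => [eF | [f + ->]]; last by rewrite inE.
  by exists (Sub e (sF e eF)); rewrite ?inE.
rewrite FX card_val; apply: leq_bigmax_cond.
by apply/asboolP/tmv_line_complete; rewrite -FX.
Qed.
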